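(* Let $G,H$ be finite groups with non-empty inverse-closed generating sets $S\subseteq G\setminus\{1\}$ and $T\subseteq H\setminus\{1\}$ respectively, let $\mathbb{F}$ be a finite field, and let $A\le\mathbb{F}^S$, $B\le\mathbb{F}^T$ be linear codes. Let $n=|G|$, $n'=|H|$, $\ell=|S|$, $\ell'=|T|$, and suppose that the Cayley codes $\mathbf{C}(G,S,A)$ and $\mathbf{C}(H,T,B)$ have ranks $k,k'$ and distances $d,d'$, respectively. Then the Cayley code $\mathbf{C}(G\times H,\,S\,\dot\cup\,T,\,A\oplus B)$, where $S,T$ are identified with $S\times 1$, $1\times T\subseteq G\times H$, has length $nn'(\ell+\ell')/2$, rank $kn'+k'n$, distance $\min\{d,d'\}$, rate $2(kn'+k'n)/(nn'(\ell+\ell'))$, and relative distance $2\min\{d,d'\}/(nn'(\ell+\ell'))$.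
   Context: For a finite set $X$, $\mathbb{F}^X$ is the $\mathbb{F}$-vector space of functions $f:X\to\mathbb{F}$. A linear code is a subspace $C\le\mathbb{F}^X$; its length is $|X|$, its rank is $\dim C$, its rate is $\dim(C)/|X|$, its distance is the minimum Hamming weight (number of non-zero entries) of a non-zero element of $C$ (defined for non-zero codes), and its relative distance is its distance divided by $|X|$. For disjoint sets $X,Y$, $\mathbb{F}^{X\dot\cup Y}=\mathbb{F}^X\oplus\mathbb{F}^Y$, so $A\oplus B\le\mathbb{F}^{S\dot\cup T}$. For a finite group $G$ and a non-empty inverse-closed subset $S\subseteq G\setminus\{1\}$, the Cayley graph $\mathrm{Cay}(G,S)$ has vertex set $G$ and edge set $E=\{\{g,sg\}\mid g\in G,\ s\in S\}$. For a linear code $B\le\mathbb{F}^S$, the Cayley code is $$\mathbf{C}(G,S,B)=\{f\in\mathbb{F}^E\mid \text{for all } g\in G, \text{ the function } S\to\mathbb{F},\ s\mapsto f(\{g,sg\}), \text{ lies in } B\}.$$ *)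

(* Defs.v *)
From HB Require Import structures.
From mathcomp Require Import all_boot all_order all_algebra all_fingroup.

Set Implicit Arguments.
Unset Strict Implicit.
Unset Printing Implicit Defensive.

Import GRing.Theory Num.Theory.

Local Open Scope ring_scope.

Notation word F X := {ffun X -> F^o}.

Notation code F X := {vspace word F X}.

Section LinearCodes.
Variables (F : finFieldType) (X : finType).
Implicit Types (C : code F X) (f : word F X).

Definition code_length C : nat := #|X|.

Definition code_rank C : nat := \dim C.

Definition code_rate C : rat := (code_rank C)%:R / (code_length C)%:R.

Definition weight f : nat := #|[set x | f x != 0]|.

(* The distance is a relation because it is undefined for the zero code. *)
Definition has_distance C (d : nat) : Prop :=
  (exists f, [/\ f \in C, f != 0 & weight f = d]) /\
  (forall f, f \in C -> f != 0 -> (d <= weight f)%N).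

Definition has_relative_distance C (r : rat) : Prop :=
  exists2 d, has_distance C d & r = d%:R / (code_length C)%:R.

End LinearCodes.

Section Pullback.
Variables (F : finFieldType) (X Y : finType) (h : X -> Y).

Definition pullback_fun (f : word F Y) : word F X := [ffun x => f (h x)].

Lemma pullback_fun_is_linear : linear pullback_fun.
Proof. by move=> a f g; apply/ffunP => x; rewrite !ffunE. Qed.

HB.instance Definition _ :=
  GRing.isLinear.Build F (word F Y) (word F X) _ pullback_fun
    pullback_fun_is_linear.

Definition pullback : 'Hom(word F Y, word F X) := linfun pullback_fun.

Lemma pullbackE f x : pullback f x = f (h x).
Proof. by rewrite lfunE ffunE. Qed.

End Pullback.

Notation elt A := {x | x \in A}.

Section CayleyCode.
Variables (gT : finGroupType) (S : {set gT}).

Definition cayley_edges : {set {set gT}} :=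
  [set [set g; (s * g)%g] | g in [set: gT], s in S].

Lemma cayley_edge_subproof (g : gT) (s : elt S) :
  [set g; (val s * g)%g] \in cayley_edges.
Proof. by apply/imset2P; exists g (val s); rewrite ?inE //; exact: valP. Qed.

Definition cayley_edge (g : gT) (s : elt S) : elt cayley_edges :=
  Sub [set g; (val s * g)%g] (cayley_edge_subproof g s).

Definition cayley_code (F : finFieldType) (B : code F (elt S)) :
    code F (elt cayley_edges) :=
  (\bigcap_(g : gT) pullback F (cayley_edge g) @^-1: B)%VS.

Lemma mem_cayley_code (F : finFieldType) (B : code F (elt S))
    (f : word F (elt cayley_edges)) :
  reflect (forall g, [ffun s => f (cayley_edge g s)] \in B)
          (f \in cayley_code B).
Proof.
rewrite memvE; apply: (iffP subv_bigcapP) => fB g.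
  by have:= fB g isT; rewrite -memvE -memv_preim lfunE.
by move=> _; rewrite -memvE -memv_preim lfunE; apply: fB.
Qed.

End CayleyCode.

Section DirectSum.
Variables (gT hT : finGroupType) (S : {set gT}) (T : {set hT}).

Definition product_gens : {set gT * hT} := setX S [1]%g :|: setX [1]%g T.

Lemma product_gens_inl_subproof (s : elt S) : (val s, 1%g) \in product_gens.
Proof. by rewrite !inE eqxx andbT (valP s). Qed.

Lemma product_gens_inr_subproof (t : elt T) : (1%g, val t) \in product_gens.
Proof. by rewrite !inE eqxx /= (valP t) orbT. Qed.

Definition product_gens_inl (s : elt S) : elt product_gens :=
  Sub (val s, 1%g) (product_gens_inl_subproof s).

Definition product_gens_inr (t : elt T) : elt product_gens :=
  Sub (1%g, val t) (product_gens_inr_subproof t).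

(* A (+) B: when 1 is in neither S nor T, a function on the disjoint union of
   S x 1 and 1 x T is the same as the pair of its restrictions, read along
   s |-> (s, 1) and t |-> (1, t) as functions on S and T; it lies in A (+) B
   when the first is in A and the second is in B. *)
Definition direct_sum (F : finFieldType) (A : code F (elt S))
    (B : code F (elt T)) : code F (elt product_gens) :=
  (pullback F product_gens_inl @^-1: A
     :&: pullback F product_gens_inr @^-1: B)%VS.

Lemma mem_direct_sum (F : finFieldType) (A : code F (elt S))
    (B : code F (elt T)) (f : word F (elt product_gens)) :
  (f \in direct_sum A B) =
  ([ffun s => f (product_gens_inl s)] \in A) &&
  ([ffun t => f (product_gens_inr t)] \in B).
Proof. by rewrite memv_cap -!memv_preim !lfunE. Qed.

End DirectSum.

(* Main.v *)
Require Import Defs.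
From mathcomp Require Import all_boot all_order all_algebra all_fingroup.
From mathcomp Require Import finfield.

Import GRing.Theory Num.Theory.

Local Open Scope ring_scope.

(* Every edge of Cay(G x H, S + T) lies in exactly one of the |H| layers
   Cay(G, S) x {h} or one of the |G| layers {g} x Cay(H, T).  Restriction to
   the layers identifies C(G x H, S + T, A (+) B) with the direct sum of |H|
   copies of C(G, S, A) and |G| copies of C(H, T, B), and the weight of a
   codeword is the sum of the weights of its restrictions. *)

(** * Hamming weights *)

Section Weight.
Context {F : finFieldType} {X : finType}.

Lemma weight0 : weight (0 : word F X) = 0%N.
Proof. by apply: eq_card0 => x; rewrite !inE ffunE eqxx. Qed.

Lemma weight_neq0 (f : word F X) : (0 < weight f)%N -> f != 0.
Proof. by apply: contraTneq => ->; rewrite weight0. Qed.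

Lemma weight_gt0 (f : word F X) : f != 0 -> (0 < weight f)%N.
Proof.
move=> f0; rewrite card_gt0; apply: contraNneq f0 => /setP supp0.
apply/eqP/ffunP => x; have := supp0 x; rewrite !inE ffunE.
by move/negbFE/eqP.
Qed.

Lemma weightE (f : word F X) : weight f = (\sum_x (f x != 0%R))%N.
Proof.
rewrite /weight cardsE -sum1_card [LHS]big_mkcond; apply: eq_bigr => x _.
by rewrite -topredE /=; case: (f x != 0).
Qed.

End Weight.

(** * Counting the edges of a Cayley graph *)

Section CayleyEdges.
Context {gT : finGroupType} {S : {set gT}}.

Lemma cayley_edgesP (X : {set gT}) :
  reflect (exists2 s, s \in S & exists g, X = [set g; s * g]%g)
          (X \in cayley_edges S).
Proof.
apply: (iffP imset2P) => [[g s _ Ss ->]|[s Ss [g ->]]]; last by exists g s.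
by exists s => //; exists g.
Qed.

(** Double counting: the edge {g, sg} arises from exactly two pairs of a vertex and a generator,
    namely (g, s) and (sg, s^-1). They differ because s is not 1, and inverse-closure makes s^-1 a
    generator. *)
Lemma card_cayley_edges :
  S \subset [set~ 1%g] -> (S^-1)%g = S ->
  (#|cayley_edges S| * 2 = #|gT| * #|S|)%N.
Proof.
move=> S_sub S_inv; pose ends (p : gT * gT) := [set p.1; p.2 * p.1]%g.
have edgesE : cayley_edges S = [set ends p | p in setX [set: gT] S].
  by rewrite /cayley_edges curry_imset2X; apply: eq_imset => -[].
have S1 s : s \in S -> (s == 1)%g = false.
  by move=> Ss; apply/negbTE; have := subsetP S_sub s Ss; rewrite !inE.
rewrite -[#|gT|]cardsT -cardsX -[RHS]sum1_card (partition_big_imset ends) /= -edgesE.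
rewrite -sum_nat_const; apply: eq_bigr => _ /cayley_edgesP[s Ss [g ->]].
have /esym := cards2 (g, s) (s * g, s^-1)%g.
rewrite xpair_eqE -{1}[g]mul1g (inj_eq (mulIg g)) eq_sym S1 //= => card2.
rewrite [LHS]card2 -sum1_card; apply: eq_bigl => -[g' s'].
rewrite !inE /= !xpair_eqE /ends /=; apply/idP/andP.
  case/orP=> /andP[/eqP-> /eqP->] //; split=> //.
    by rewrite -mem_invg S_inv.
  by rewrite mulKg setUC.
case=> Ss' /eqP eq_ends.
(* A pair (g', s') with the same ends starts at g or at sg. Since s' is not 1, its other end is the
   other vertex, which forces s' = s or s's = 1 respectively. *)
have /set2P[g'E|g'E] : g' \in [set g; s * g]%g by rewrite -eq_ends set21.
  have : (s' * g')%g \in [set g; s * g]%g by rewrite -eq_ends set22.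
  rewrite g'E !inE -{2}[g]mul1g !(inj_eq (mulIg g)) S1 //= => /eqP->.
  by rewrite !eqxx.
have : (s' * g')%g \in [set g; s * g]%g by rewrite -eq_ends set22.
rewrite g'E !inE -{3}[(s * g)%g]mul1g (inj_eq (mulIg _)) S1 // orbF.
rewrite mulgA -{2}[g]mul1g (inj_eq (mulIg g)) => s's1.
by rewrite eqxx [(s' == s^-1)%g]eq_mulgV1 invgK s's1 orbT.
Qed.

End CayleyEdges.

(** Used to express the rate and the relative distance over twice the length. *)
Lemma natr_div_double (m N : nat) : m%:R / N%:R = 2 * m%:R / (N * 2)%:R :> rat.
Proof.
by rewrite natrM invfM [2 * _]mulrC mulrA [_ * 2 / _]mulrAC mulfK.
Qed.

(** * Layers of the product graph, and words on them *)

Section ProductEdges.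
Context {gT hT : finGroupType} {S : {set gT}} {T : {set hT}}.
Hypothesis S_sub : S \subset [set~ 1%g].
Hypothesis T_sub : T \subset [set~ 1%g].

Let E1 := elt (cayley_edges S).
Let E2 := elt (cayley_edges T).
Let E := elt (cayley_edges (product_gens S T)).

Lemma product_gens_sub : product_gens S T \subset [set~ 1%g].
Proof.
apply/subsetP => -[g h]; rewrite !inE /= xpair_eqE => /orP[]/andP[].
  by move=> /(subsetP S_sub); rewrite !inE => /negbTE->.
by move=> _ /(subsetP T_sub); rewrite !inE andbC => /negbTE->.
Qed.

Lemma product_gens_inv :
  (S^-1)%g = S -> (T^-1)%g = T -> ((product_gens S T)^-1)%g = product_gens S T.
Proof.
move=> S_inv T_inv; apply/setP => -[g h].
by rewrite !inE /= !invg_eq1 -!mem_invg S_inv T_inv.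
Qed.

Lemma card_product_gens : #|product_gens S T| = (#|S| + #|T|)%N.
Proof.
rewrite /product_gens cardsU !cardsX !cards1 muln1 mul1n.
suff -> : setX S 1%g :&: setX 1%g T = set0 by rewrite cards0 subn0.
apply/setP=> -[g h]; rewrite !inE /=; apply/negP => /andP[/andP[Sg _] /andP[/eqP g1 _]].
by have := subsetP S_sub g Sg; rewrite !inE g1 eqxx.
Qed.

Lemma edgel_subproof (e : E1) (h : hT) :
  setX (val e) [set h] \in cayley_edges (product_gens S T).
Proof.
case: e => X /= /cayley_edgesP[s Ss [g ->]]; apply/cayley_edgesP.
exists (s, 1%g); first by rewrite !inE Ss eqxx.
exists (g, h); apply/setP => -[a b].
by rewrite !inE !xpair_eqE /= mul1g; case: (b == h); rewrite ?andbT ?andbF.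
Qed.

Lemma edger_subproof (e : E2) (g : gT) :
  setX [set g] (val e) \in cayley_edges (product_gens S T).
Proof.
case: e => X /= /cayley_edgesP[t Tt [h ->]]; apply/cayley_edgesP.
exists (1%g, t); first by rewrite !inE Tt eqxx orbT.
exists (g, h); apply/setP => -[a b].
by rewrite !inE !xpair_eqE /= mul1g; case: (a == g).
Qed.

(** Edges are vertex sets, so the copy of an edge in a layer is a Cartesian product with a
    singleton, with no choice of endpoint or generator. *)
Definition layer_edge (x : E1 * hT + E2 * gT) : E :=
  match x with
  | inl (e, h) => Sub (setX (val e) [set h]) (edgel_subproof e h)
  | inr (e, g) => Sub (setX [set g] (val e)) (edger_subproof e g)
  end.

Lemma layer_edge_inl g h (s : elt S) :
  layer_edge (inl (cayley_edge g s, h)) =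
  cayley_edge (g, h) (product_gens_inl T s).
Proof.
apply: val_inj; apply/setP => -[a b].
by rewrite !inE !xpair_eqE /= mul1g; case: (b == h); rewrite ?andbT ?andbF.
Qed.

Lemma layer_edge_inr g h (t : elt T) :
  layer_edge (inr (cayley_edge h t, g)) =
  cayley_edge (g, h) (product_gens_inr S t).
Proof.
apply: val_inj; apply/setP => -[a b].
by rewrite !inE !xpair_eqE /= mul1g; case: (a == g).
Qed.

(** Exactly one coordinate is constant along an edge: it determines the layer, and the other
    coordinate gives back the edge inside it. Every edge is reached because each generator is some
    (s, 1) or (1, t). *)
Lemma layer_edge_bij : bijective layer_edge.
Proof.
have ne1 g s : s \in S -> (s * g)%g <> g.
  move=> Ss /(canRL (mulgK g)); rewrite mulgV => s1.
  by have := subsetP S_sub s Ss; rewrite !inE s1 eqxx.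
have inj : injective layer_edge.
  case=> [[[X /= EX] h]|[[X /= EX] g]] [[[Y /= EY] h']|[[Y /= EY] g']];
    move=> /(congr1 val) /= /setP eqXY.
  - have eq_h : h = h'.
      case/cayley_edgesP: (EX) eqXY => s _ [g ->] /(_ (g, h)).
      by rewrite !inE !eqxx /= => /esym /andP[_ /eqP].
    congr (inl (_, _)) => //; apply: val_inj; apply/setP => a /=.
    by have := eqXY (a, h); rewrite !inE -eq_h eqxx !andbT.
  (* Layers of different kinds: both g and sg would equal the one constant first coordinate,
     contradicting s != 1. *)
  - exfalso; case/cayley_edgesP: (EX) eqXY => s Ss [g ->] eqXY.
    have := eqXY (g, h); have := eqXY (s * g, h)%g.
    rewrite !inE !eqxx orbT /= => /esym /andP[/eqP sg _] /esym /andP[/eqP g1 _].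
    by apply: (ne1 g s Ss); rewrite sg g1.
  - exfalso; case/cayley_edgesP: (EY) eqXY => s Ss [g1 ->] eqXY.
    have := eqXY (g1, h'); have := eqXY (s * g1, h')%g.
    rewrite !inE !eqxx orbT /= => /andP[/eqP sg _] /andP[/eqP g1E _].
    by apply: (ne1 g1 s Ss); rewrite sg g1E.
  - have eq_g : g = g'.
      case/cayley_edgesP: (EX) eqXY => s _ [h ->] /(_ (g, h)).
      by rewrite !inE !eqxx /= => /esym /andP[/eqP].
    congr (inr (_, _)) => //; apply: val_inj; apply/setP => a /=.
    by have := eqXY (g, a); rewrite !inE -eq_g eqxx.
(* Given injectivity, it is enough that [E] has no more elements than the image, which holds as
   every edge lies in it. *)
apply: inj_card_bij => //; rewrite -(card_codom inj); apply: subset_leq_card.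
apply/subsetP => -[X EX] _; apply/codomP.
case/imset2P: (EX) => -[g h] [s t] _; rewrite !inE /= => st XE.
case/orP: st => /andP[st1 st2].
  exists (inl (cayley_edge g (Sub s st1), h)); rewrite layer_edge_inl.
  by apply: val_inj; rewrite /= XE (eqP st2).
exists (inr (cayley_edge h (Sub t st2), g)); rewrite layer_edge_inr.
by apply: val_inj; rewrite /= XE (eqP st1).
Qed.

Context {F : finFieldType}.

(** Families of words are finite functions, so that families of codewords are counted by
    [ffun_on]. *)
Definition layers (f : word F E) :
    {ffun hT -> word F E1} * {ffun gT -> word F E2} :=
  ([ffun h => [ffun e => f (layer_edge (inl (e, h)))]],
   [ffun g => [ffun e => f (layer_edge (inr (e, g)))]]).

Lemma layers_bij : bijective layers.
Proof.
have [inv layerK invK] := layer_edge_bij.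
pose glue (uv : {ffun hT -> word F E1} * {ffun gT -> word F E2}) : word F E :=
  [ffun x => match inv x with
             | inl (e, h) => uv.1 h e
             | inr (e, g) => uv.2 g e
             end].
exists glue => [f|[u v]].
  apply/ffunP => x; rewrite ffunE -{2}[x]invK.
  by case: (inv x) => -[e z]; rewrite !ffunE.
by congr (_, _); apply/ffunP => z; apply/ffunP => e; rewrite !ffunE layerK.
Qed.

Lemma weight_layers (f : word F E) :
  weight f = (\sum_h weight ((layers f).1 h) + \sum_g weight ((layers f).2 g))%N.
Proof.
rewrite weightE (reindex layer_edge) /=; last exact: onW_bij layer_edge_bij.
rewrite big_sumType /=; congr addn.
  under [RHS]eq_bigr do rewrite weightE.
  rewrite exchange_big pair_big; apply: eq_bigr => -[e h] _.
  by rewrite !ffunE.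
under [RHS]eq_bigr do rewrite weightE.
by rewrite exchange_big pair_big; apply: eq_bigr => -[e h] _; rewrite !ffunE.
Qed.

(** The local view at g of layer h is the S-part of the local view at (g, h). The right side has the
    nested form that [mem_cayley_code] and [mem_direct_sum] produce. *)
Lemma layers_inl (f : word F E) g h :
  [ffun s => (layers f).1 h (cayley_edge g s)] =
  [ffun s => [ffun s' => f (cayley_edge (g, h) s')] (product_gens_inl T s)].
Proof. by apply/ffunP => s; rewrite !ffunE layer_edge_inl. Qed.

Lemma layers_inr (f : word F E) g h :
  [ffun t => (layers f).2 g (cayley_edge h t)] =
  [ffun t => [ffun t' => f (cayley_edge (g, h) t')] (product_gens_inr S t)].
Proof. by apply/ffunP => t; rewrite !ffunE layer_edge_inr. Qed.

(** * Rank and distance of the product code *)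

Context {A : code F (elt S)} {B : code F (elt T)}.

(** The condition at (g, h) splits into the condition for [A] at g in layer h and the condition for
    [B] at h in layer g. *)
Lemma mem_cayley_code_layers (f : word F E) :
  (f \in cayley_code (direct_sum A B)) =
  ((layers f).1 \in ffun_on (mem (cayley_code A))) &&
  ((layers f).2 \in ffun_on (mem (cayley_code B))).
Proof.
apply/mem_cayley_code/andP => [fC|[/ffun_onP fA /ffun_onP fB] [g h]].
  split; apply/ffun_onP => x; apply/mem_cayley_code => y.
    by have := fC (y, x); rewrite mem_direct_sum layers_inl => /andP[].
  by have := fC (x, y); rewrite mem_direct_sum layers_inr => /andP[].
rewrite mem_direct_sum -layers_inl -layers_inr.
by apply/andP; split; apply/mem_cayley_code.
Qed.

(* Ranks are compared by counting codewords: a code of rank r has |F|^r. *)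
Lemma code_rank_product :
  code_rank (cayley_code (direct_sum A B)) =
  (code_rank (cayley_code A) * #|hT| + code_rank (cayley_code B) * #|gT|)%N.
Proof.
apply: (expnI (finNzRing_gt1 F)); rewrite expnD !expnM /code_rank -!card_vspace.
rewrite -!card_ffun_on -cardX -(on_card_preimset (onW_bij _ layers_bij)).
by apply: eq_card => f; rewrite !inE mem_cayley_code_layers.
Qed.

Lemma has_distance_product (d d' : nat) :
  has_distance (cayley_code A) d -> has_distance (cayley_code B) d' ->
  has_distance (cayley_code (direct_sum A B)) (minn d d').
Proof.
case=> -[a [Aa a0 wa]] minA [[b [Bb b0 wb]] minB]; split; last first.
  move=> f; rewrite mem_cayley_code_layers => /andP[/ffun_onP fA /ffun_onP fB].
  (* A positive total weight has a positive summand, so some layer carries a non-zero codeword,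
     whose weight bounds the total from below. *)
  move=> /weight_gt0; rewrite weight_layers addn_gt0 !lt0n !sum_nat_eq0.
  case/orP=> /forallPn[x]; rewrite -lt0n => /weight_neq0 fx0.
    rewrite geq_min (leq_trans (minA _ (fA x) fx0)) //.
    by rewrite (bigD1 x) //= -addnA leq_addr.
  rewrite geq_min orbC (leq_trans (minB _ (fB x) fx0)) //.
  by rewrite addnC (bigD1 x) //= -addnA leq_addr.
have [inv _ invK] := layers_bij.
have [le_dd'|lt_d'd] := leqP d d'.
  (* A minimum-weight codeword placed in the layer over 1 and extended by zero keeps its weight. *)
  exists (inv ([ffun h => if h == 1%g then a else 0], [ffun=> 0])).
  set f := inv _; have wf : weight f = d.
    rewrite weight_layers invK /= (bigD1 1%g) //= ffunE eqxx wa.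
    rewrite !big1 ?addn0 // => [g _|h /negbTE h1]; rewrite ffunE ?h1 weight0 //.
  split=> //; last by apply: weight_neq0; rewrite wf -wa weight_gt0.
  rewrite mem_cayley_code_layers invK; apply/andP.
  by split; apply/ffun_onP => x; rewrite ffunE ?mem0v //; case: ifP; rewrite ?mem0v.
exists (inv ([ffun=> 0], [ffun g => if g == 1%g then b else 0])).
set f := inv _; have wf : weight f = d'.
  rewrite weight_layers invK /= addnC (bigD1 1%g) //= ffunE eqxx wb.
  rewrite !big1 ?addn0 // => [h _|g /negbTE g1]; rewrite ffunE ?g1 weight0 //.
split=> //; last by apply: weight_neq0; rewrite wf -wb weight_gt0.
rewrite mem_cayley_code_layers invK; apply/andP.
by split; apply/ffun_onP => x; rewrite ffunE ?mem0v //; case: ifP; rewrite ?mem0v.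
Qed.

End ProductEdges.

Theorem mainTheorem5 (gT hT : finGroupType) (S : {set gT}) (T : {set hT})
    (S_neq0 : S != set0) (T_neq0 : T != set0)
    (S_sub : S \subset [set~ 1%g]) (T_sub : T \subset [set~ 1%g])
    (S_inv : (S^-1)%g = S) (T_inv : (T^-1)%g = T)
    (S_gen : <<S>>%g = [set: gT]) (T_gen : <<T>>%g = [set: hT])
    (F : finFieldType) (A : code F (elt S)) (B : code F (elt T))
    (n n' l l' k k' d d' : nat)
    (n_def : n = #|gT|) (n'_def : n' = #|hT|)
    (l_def : l = #|S|) (l'_def : l' = #|T|)
    (rank_A : code_rank (cayley_code A) = k)
    (rank_B : code_rank (cayley_code B) = k')
    (dist_A : has_distance (cayley_code A) d)
    (dist_B : has_distance (cayley_code B) d') :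
  let C := cayley_code (direct_sum A B) in
  [/\ (code_length C)%:R = n%:R * n'%:R * (l%:R + l'%:R) / 2 :> rat,
      code_rank C = (k * n' + k' * n)%N,
      has_distance C (minn d d'),
      code_rate C =
        2 * (k%:R * n'%:R + k'%:R * n%:R) / (n%:R * n'%:R * (l%:R + l'%:R))
    & has_relative_distance C
        (2 * (minn d d')%:R / (n%:R * n'%:R * (l%:R + l'%:R)))].
Proof.
move=> C.
have lenC : (code_length C * 2 = n * n' * (l + l'))%N.
  rewrite n_def n'_def l_def l'_def -card_prod -(card_product_gens (T := T) S_sub).
  rewrite -card_cayley_edges ?product_gens_sub ?product_gens_inv //.
  by rewrite /code_length card_sig; congr (_ * _)%N; apply: eq_card => X.
have rankC : code_rank C = (k * n' + k' * n)%N.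
  by rewrite code_rank_product // rank_A rank_B n_def n'_def.
have distC : has_distance C (minn d d') by apply: has_distance_product.
(* The common denominator is twice the length, so the three rational claims reduce to cancelling a
   factor 2. *)
have -> : n%:R * n'%:R * (l%:R + l'%:R) = (code_length C * 2)%:R :> rat.
  by rewrite lenC !natrM natrD.
split=> //.
- by rewrite natrM mulfK.
- by rewrite -!natrM -natrD -rankC -natr_div_double.
by exists (minn d d'); rewrite -?natr_div_double.
Qed.
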